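(* Let $f$ be a smooth $2\pi$-periodic function with $\int_0^{2\pi} f(x)\,dx=0$, let $u_0$ be a smooth $2\pi$-periodic function with $u_0(x)<0$ and $u_0(x)u_0'(x)=f(x)$ for all $x$, let $u_1,u_2,\dots$ be the smooth $2\pi$-periodic functions determined from $u_0$ by the recurrence in the context, and let $n$ be a positive integer. Then there exist $\varepsilon_0>0$, depending on $n$, and a constant $C>0$, depending on $n$ but independent of $\varepsilon$, such that for every $0<\varepsilon<\varepsilon_0$ the equation $$u(x)u'(x)-\varepsilon u''(x)=f(x),\qquad x\in[0,2\pi],$$ has a periodic solution $u^\varepsilon\in C^2([0,2\pi])$, i.e. a solution with $u^\varepsilon(0)=u^\varepsilon(2\pi)$, satisfying $$|u^\varepsilon(x)-u_0(x)-\varepsilon u_1(x)-\cdots-\varepsilon^n u_n(x)|\le C\varepsilon^{n+1}\qquad\text{for all }x\in[0,2\pi].$$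
   Context: All functions are real-valued. Given $u_0$ smooth, $2\pi$-periodic and everywhere negative, the functions $u_k$, $k\ge 1$, are defined recursively by $$u_0(x)u_k(x)=u_{k-1}'(x)-\frac12\sum_{\substack{i+j=k\\ i,j\ge 1}}u_i(x)u_j(x),\qquad k=1,2,\dots$$ (for $k=1$ the sum is empty). Since $u_0$ never vanishes, each $u_k$ is a well-defined smooth $2\pi$-periodic function. The constants $\varepsilon_0$ and $C$ may depend on $f$, $u_0$ and $n$. *)

(* Defs.v *)
From Stdlib Require Import Reals.
From Coquelicot Require Import Coquelicot.

Open Scope R_scope.

Definition smooth (f : R -> R) : Prop :=
  forall (n : nat) (x : R), ex_derive_n f n x.

Definition periodic (f : R -> R) : Prop :=
  forall x : R, f (x + 2 * PI) = f x.

(* The index is shifted (k is written S k, with k >= 0), so that the sum over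
   i + j = S k with i, j >= 1 runs over 1 <= i <= k; it is empty for k = 0. *)
Definition expansion_recurrence (u : nat -> R -> R) : Prop :=
  forall (k : nat) (x : R),
    u 0%nat x * u (S k) x =
    Derive (u k) x - / 2 * sum_n_m (fun i => u i x * u (S k - i)%nat x) 1 k.

Definition period_interval (x : R) : Prop := 0 <= x <= 2 * PI.

(* [v] is of class C^2 on [0, 2 PI], with first and second derivatives [dv] and
   [ddv]: [D_in] is differentiability relative to the interval, hence one-sided
   at the end points, and the values of the functions elsewhere are irrelevant. *)
Definition C2_with_derivatives (v dv ddv : R -> R) : Prop :=
  (forall x, period_interval x -> D_in v dv period_interval x) /\
  (forall x, period_interval x -> D_in dv ddv period_interval x) /\
  continuous_on period_interval ddv.

Definition periodic_C2_solution (f : R -> R) (eps : R) (v : R -> R) : Prop :=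
  exists dv ddv : R -> R,
    C2_with_derivatives v dv ddv /\
    (forall x, period_interval x -> v x * dv x - eps * ddv x = f x) /\
    v 0 = v (2 * PI).

(* Main.v *)
Require Import Defs.
From Stdlib Require Import Reals Arith Lra Lia.
From Coquelicot Require Import Coquelicot.
Open Scope R_scope.

(** The equation has a first integral.  Since [u0 u0' = f], a function [v] with
    [eps v' = (v^2 - u0^2) / 2] satisfies, after one differentiation,
    [v v' - eps v'' = f].  The integration constant is chosen so that substituting
    the formal series [sum eps^k u_k] into this Riccati equation gives back exactly
    the recurrence that defines the [u_k].

    Let [w] be the partial sum up to [eps^n].  By the recurrence, its residual
    [rho = eps w' - (w^2 - u0^2) / 2] is [O(eps^(n+1))]
    ([partial_expansion_residual]).  Writing [v = w + Z], the equation becomes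
    [eps Z' = w Z + Z^2 / 2 - rho], where, because [u0 < 0], one has [w <= - mu < 0]
    uniformly for small [eps].  For a negative coefficient [a], the linear equation
    [Z' = a Z + h] has a periodic solution, given by variation of constants
    ([periodic_linear_solution_spec]), and if [a <= - m] then [|h| <= m B] forces
    [|Z| <= B] ([periodic_linear_bound]).  With [a = w / eps] the factor [1 / eps]
    appears both in [h] and in [m], so it cancels: the map sending [z] to the
    periodic solution of [eps Z' = w Z + z^2 / 2 - rho] is a contraction of a ball of
    radius [O(eps^(n+1))], with constants independent of [eps].  Its fixed point
    ([periodic_riccati]) is the required correction. *)

(** * Smoothness and periodicity of the coefficients *)

(** The product rule expresses the derivative of [f g] through factors of one order
    less, so closure under products and inverses has to be proved by induction on a
    finite order of differentiability; [smooth] is the case of all orders. *)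
Definition times_differentiable (n : nat) (f : R -> R) : Prop :=
  forall k x, (k <= n)%nat -> ex_derive_n f k x.

Lemma times_differentiable_S n f :
  times_differentiable (S n) f <->
  (forall x, ex_derive f x) /\ times_differentiable n (Derive f).
Proof.
  assert (shift : forall k x, ex_derive_n (Derive f) (S k) x <->
                              ex_derive_n f (S (S k)) x).
  { intros k x. simpl.
    assert (E : forall t, Derive_n (Derive f) k t = Derive (Derive_n f k) t).
    { intro t. replace (Derive (Derive_n f k) t) with (Derive_n f (k + 1) t).
      - exact (Derive_n_comp f k 1 t).
      - now rewrite Nat.add_1_r. }
    split; apply ex_derive_ext; intro t; now rewrite E. }
  split.
  - intro H. split.
    + intro x. apply (H 1%nat x). lia.
    + intros [|k] x Hk; [exact I|]. apply (proj2 (shift k x)), H. lia.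
  - intros [H1 H] [|[|k]] x Hk; [exact I|exact (H1 x)|].
    apply (proj1 (shift k x)), H. lia.
Qed.

Lemma times_differentiable_pred n f :
  times_differentiable (S n) f -> times_differentiable n f.
Proof. intros H k x Hk. apply H. lia. Qed.

Lemma times_differentiable_ext n f g :
  (forall x, f x = g x) -> times_differentiable n f -> times_differentiable n g.
Proof. intros E H k x Hk. apply (ex_derive_n_ext f); auto. Qed.

Lemma times_differentiable_minus n f g :
  times_differentiable n f -> times_differentiable n g ->
  times_differentiable n (fun x => f x - g x).
Proof.
  intros Hf Hg k x Hk.
  apply ex_derive_n_minus; apply filter_forall; intros y j Hj;
    [apply Hf|apply Hg]; lia.
Qed.

Lemma times_differentiable_scal n c f :
  times_differentiable n f -> times_differentiable n (fun x => c * f x).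
Proof. intros H k x Hk. apply ex_derive_n_scal_l. now apply H. Qed.

(** Only [f], [g] and the two first derivatives occur in [(f g)'], all of them
    differentiable [n] times when [f] and [g] are so [n + 1] times. *)
Lemma times_differentiable_mult n f g :
  times_differentiable n f -> times_differentiable n g ->
  times_differentiable n (fun x => f x * g x).
Proof.
  revert f g. induction n as [|n IH]; intros f g Hf Hg.
  - intros k x Hk. replace k with 0%nat by lia. exact I.
  - pose proof (times_differentiable_pred _ _ Hf) as Hf0.
    pose proof (times_differentiable_pred _ _ Hg) as Hg0.
    apply times_differentiable_S in Hf as [Hf Hf'].
    apply times_differentiable_S in Hg as [Hg Hg'].
    apply times_differentiable_S. split.
    + intro x. now apply ex_derive_mult.
    + apply (times_differentiable_ext _
        (fun x => Derive f x * g x - -1 * (f x * Derive g x))).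
      { intro x. rewrite Derive_mult; auto. ring. }
      apply times_differentiable_minus; [now apply IH|].
      now apply times_differentiable_scal, IH.
Qed.

(** [(1 / f)' = - f' (1 / f)^2] gains one order from the lower-order statement for
    [1 / f] itself. *)
Lemma times_differentiable_inv n f :
  (forall x, f x <> 0) ->
  times_differentiable n f -> times_differentiable n (fun x => / f x).
Proof.
  intro f0. induction n as [|n IH]; intro Hf.
  - intros k x Hk. replace k with 0%nat by lia. exact I.
  - specialize (IH (times_differentiable_pred _ _ Hf)).
    apply times_differentiable_S in Hf as [Hf Hf'].
    apply times_differentiable_S. split.
    + intro x. now apply ex_derive_inv.
    + apply (times_differentiable_ext _
        (fun x => -1 * (Derive f x * (/ f x * / f x)))).
      { intro x. rewrite Derive_inv; auto. now field. }
      apply times_differentiable_scal.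
      apply times_differentiable_mult; [exact Hf'|].
      now apply times_differentiable_mult.
Qed.

Lemma periodic_Derive f :
  periodic f -> periodic (Derive f).
Proof.
  intros Hf x.
  transitivity (Derive (fun y => f (y + 2 * PI)) x).
  - symmetry. exact (Derive_n_comp_trans f 1 x (2 * PI)).
  - now apply Derive_ext.
Qed.

Lemma expansion_smooth u :
  smooth (u 0%nat) -> (forall x, u 0%nat x < 0) -> expansion_recurrence u ->
  forall k, smooth (u k).
Proof.
  intros H0 neg rec k. induction k as [k IH] using lt_wf_ind.
  destruct k as [|k]; [exact H0|].
  assert (nz : forall x, u 0%nat x <> 0) by (intro x; specialize (neg x); lra).
  enough (H : forall m, times_differentiable m (u (S k))).
  { intros m x. now apply (H m). }
  assert (below : forall m j, (j <= k)%nat -> times_differentiable m (u j)).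
  { intros m j Hj i x _. apply IH. lia. }
  intro m.
  apply (times_differentiable_ext _ (fun x =>
    / u 0%nat x * (Derive (u k) x -
      / 2 * sum_n_m (fun i => u i x * u (S k - i)%nat x) 1 k))).
  { intro x. rewrite <- rec. now field. }
  apply times_differentiable_mult.
  { apply times_differentiable_inv; auto. apply below; lia. }
  apply times_differentiable_minus.
  { now apply times_differentiable_S, below. }
  apply times_differentiable_scal. intros i x Hi.
  apply (ex_derive_n_sum_n_m 1 k (fun l y => u l y * u (S k - l)%nat y)).
  apply filter_forall. intros t l j Hl Hj.
  apply (times_differentiable_mult j); [apply below|apply below|]; lia.
Qed.

Lemma expansion_periodic u :
  periodic (u 0%nat) -> (forall x, u 0%nat x < 0) -> expansion_recurrence u ->
  forall k, periodic (u k).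
Proof.
  intros H0 neg rec k. induction k as [k IH] using lt_wf_ind.
  destruct k as [|k]; [exact H0|]. intro x.
  assert (nz : u 0%nat x <> 0) by (specialize (neg x); lra).
  apply (Rmult_eq_reg_l (u 0%nat x)); [|exact nz].
  rewrite <- (H0 x) at 1. rewrite !rec.
  rewrite (periodic_Derive (u k)); [|apply IH; lia].
  do 2 f_equal. apply sum_n_m_ext_loc. intros i Hi.
  rewrite (IH i), (IH (S k - i)%nat); [reflexivity|lia|lia].
Qed.

(** * The residual of the truncated expansion *)

(** The two extreme terms of the convolution contribute [2 u_0 u_(k+1)]; the other
    ones are the sum in the recurrence.  So the recurrence says that the coefficient
    of [eps^(k+1)] vanishes in [eps w' - w^2 / 2]. *)
Lemma expansion_self_convolution u (k : nat) x :
  expansion_recurrence u ->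
  sum_n (fun p => u p x * u (S k - p)%nat x) (S k) = 2 * Derive (u k) x.
Proof.
  intro rec. unfold sum_n. rewrite sum_Sn_m by lia.
  rewrite sum_n_Sm by lia. specialize (rec k x).
  replace (S k - 0)%nat with (S k) by lia. rewrite Nat.sub_diag.
  change plus with Rplus. lra.
Qed.

Lemma sum_n_Rabs_le (a : nat -> R) n b :
  (forall k, (k <= n)%nat -> Rabs (a k) <= b) ->
  Rabs (sum_n a n) <= INR (S n) * b.
Proof.
  induction n as [|n IH]; intro H.
  - rewrite sum_O. simpl. rewrite Rmult_1_l. now apply H.
  - rewrite sum_Sn, S_INR. change plus with Rplus.
    pose proof (H (S n) (Nat.le_refl _)).
    assert (Rabs (sum_n a n) <= INR (S n) * b) by (apply IH; intros; apply H; lia).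
    pose proof (Rabs_triang (sum_n a n) (a (S n))). lra.
Qed.

Definition partial_expansion (u : nat -> R -> R) n eps x : R :=
  sum_n (fun k => eps ^ k * u k x) n.

(** The left-hand side collects the terms of [w^2] of order at most [n] in [eps].
    Order by order it agrees with [u_0^2 + 2 eps w'], whose last term, of order
    [n + 1], has no counterpart and is subtracted. *)
Lemma partial_expansion_convolution u n eps x :
  expansion_recurrence u ->
  sum_n (fun k => sum_n (fun p => (eps ^ p * u p x) *
                                  (eps ^ (k - p) * u (k - p)%nat x)) k) n =
  u 0%nat x ^ 2 + 2 * eps * sum_n (fun k => eps ^ k * Derive (u k) x) n
  - 2 * eps ^ (n + 1) * Derive (u n) x.
Proof.
  intro rec.
  assert (term : forall k,
    sum_n (fun p => (eps ^ p * u p x) * (eps ^ (S k - p) * u (S k - p)%nat x)) (S k)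
    = eps ^ S k * (2 * Derive (u k) x)).
  { intro k. rewrite <- (expansion_self_convolution u k x rec).
    etransitivity; [|exact (sum_n_mult_l (K := R_Ring) _ _ _)].
    apply sum_n_ext_loc. intros p Hp.
    change mult with Rmult.
    match goal with |- ?l = ?r => change (@eq R l r) end.
    replace (S k) with (p + (S k - p))%nat at 3 by lia. rewrite pow_add. ring. }
  induction n as [|n IH].
  - rewrite !sum_O. simpl. ring.
  - rewrite (sum_Sn _ n), IH, term, (sum_Sn _ n). change plus with Rplus.
    rewrite Nat.add_1_r, Nat.add_succ_r, Nat.add_0_r. simpl. ring.
Qed.

(** What is left are the term [eps^(n+1) u_n'] and the products
    [eps^(i+j) u_i u_j] with [i, j <= n < i + j], at most [n * n] in number. *)
Lemma partial_expansion_residual u n M eps x :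
  expansion_recurrence u -> (0 < n)%nat -> 0 <= eps <= 1 ->
  (forall k, (k <= n)%nat -> Rabs (u k x) <= M) ->
  Rabs (Derive (u n) x) <= M ->
  Rabs (eps * sum_n (fun k => eps ^ k * Derive (u k) x) n
        - (partial_expansion u n eps x ^ 2 - u 0%nat x ^ 2) / 2)
  <= (M + INR n * (INR n * M ^ 2)) * eps ^ (n + 1).
Proof.
  intros rec n_pos Heps HM HM'.
  pose proof (cauchy_finite (fun k => eps ^ k * u k x) (fun k => eps ^ k * u k x)
    n n_pos) as C.
  set (tail := sum_f_R0 _ (Init.Nat.pred n)) in C.
  assert (sq : partial_expansion u n eps x ^ 2 =
    u 0%nat x ^ 2 + 2 * eps * sum_n (fun k => eps ^ k * Derive (u k) x) n
    - 2 * eps ^ (n + 1) * Derive (u n) x + tail).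
  { rewrite <- partial_expansion_convolution by exact rec.
    unfold partial_expansion. rewrite <- Rsqr_pow2. unfold Rsqr.
    rewrite sum_n_Reals, C. f_equal. rewrite sum_n_Reals.
    apply sum_eq. intros k _. now rewrite sum_n_Reals. }
  assert (M0 : 0 <= M) by (pose proof (Rabs_pos (Derive (u n) x)); lra).
  assert (e0 : forall k, 0 <= eps ^ k) by (intro; apply pow_le; lra).
  assert (tail_le : Rabs tail <= INR n * (INR n * (M ^ 2 * eps ^ (n + 1)))).
  { unfold tail. rewrite <- sum_n_Reals.
    replace (INR n * (INR n * (M ^ 2 * eps ^ (n + 1)))) with
      (INR (S (Init.Nat.pred n)) * (INR n * (M ^ 2 * eps ^ (n + 1))))
      by now replace (S (Init.Nat.pred n)) with n by lia.
    apply sum_n_Rabs_le. intros k Hk. rewrite <- sum_n_Reals.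
    apply Rle_trans with (INR (S (Init.Nat.pred (n - k))) * (M ^ 2 * eps ^ (n + 1))).
    2:{ apply Rmult_le_compat_r; [|apply le_INR; lia].
        apply Rmult_le_pos; [apply pow_le; lra|apply e0]. }
    apply sum_n_Rabs_le. intros l Hl.
    replace (eps ^ S (l + k) * u (S (l + k)) x * (eps ^ (n - l) * u (n - l)%nat x))
      with ((u (S (l + k)) x * u (n - l)%nat x) * (eps ^ k * eps ^ (n + 1))).
    2:{ rewrite <- pow_add.
        replace (k + (n + 1))%nat with (S (l + k) + (n - l))%nat by lia.
        rewrite pow_add. ring. }
    rewrite !Rabs_mult, <- !RPow_abs, (Rabs_pos_eq eps) by lra.
    simpl (M ^ 2). rewrite Rmult_1_r.
    apply Rmult_le_compat; try (apply Rmult_le_pos; auto using Rabs_pos).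
    - apply Rmult_le_compat; try apply Rabs_pos; apply HM; lia.
    - rewrite <- (Rmult_1_l (eps ^ (n + 1))) at 2.
      apply Rmult_le_compat_r; [apply e0|].
      rewrite <- (pow1 k). apply pow_incr. lra. }
  rewrite sq.
  match goal with |- Rabs ?t <= _ =>
    replace t with (eps ^ (n + 1) * Derive (u n) x - / 2 * tail) by field end.
  eapply Rle_trans; [apply Rabs_triang|].
  rewrite Rabs_Ropp, !Rabs_mult, (Rabs_pos_eq (eps ^ _)), (Rabs_pos_eq (/ 2))
    by (try apply e0; lra).
  pose proof (Rmult_le_compat_l _ _ _ (e0 (n + 1)%nat) HM').
  pose proof (Rabs_pos tail). lra.
Qed.

(** * Periodic solutions of scalar linear equations *)

Lemma is_derive_primitive (a : R -> R) :
  (forall x, continuous a x) ->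
  forall x, is_derive (fun y => RInt a 0 y) x (a x).
Proof.
  intros Ha x. apply (is_derive_RInt a _ 0 x); [|apply Ha].
  apply filter_forall. intro y.
  apply (RInt_correct (V := R_CompleteNormedModule)), ex_RInt_continuous.
  intros z _. apply Ha.
Qed.

Lemma is_derive_continuous (g dg : R -> R) x :
  is_derive g x (dg x) -> continuous g x.
Proof. intro H. apply (ex_derive_continuous (V := R_NormedModule)). now exists (dg x). Qed.

Lemma mean_value (g dg : R -> R) x y :
  x <= y -> (forall t, x <= t <= y -> is_derive g t (dg t)) ->
  exists c, x <= c <= y /\ g y - g x = dg c * (y - x).
Proof.
  intros Hxy H. pose proof (MVT_gen g x y dg) as M. cbv zeta in M.
  rewrite Rmin_left, Rmax_right in M by exact Hxy.
  apply M.
  - intros t Ht. apply H. lra.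
  - intros t Ht. apply continuity_pt_filterlim.
    now apply (is_derive_continuous g dg), H.
Qed.

Lemma primitive_negative (a : R -> R) L :
  0 < L -> (forall x, continuous a x) -> (forall x, 0 <= x <= L -> a x < 0) ->
  RInt a 0 L < 0.
Proof.
  intros HL Ha neg.
  destruct (mean_value (fun y => RInt a 0 y) a 0 L) as [c [Hc E]]; [lra| |].
  { intros t _. now apply is_derive_primitive. }
  rewrite RInt_point in E. change zero with 0 in E.
  specialize (neg c Hc). nra.
Qed.

(** With [P] a primitive of [a], the function [exp (- P) (Z - B)] is nonincreasing.
    Comparing its values at [0] and [L], where [exp (- P L) > 1] and [Z 0 = Z L],
    gives [Z 0 <= B]; by monotonicity the inequality then propagates to all of
    [[0, L]]. *)
Lemma periodic_linear_le (a h Z : R -> R) L B :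
  0 < L -> (forall x, continuous a x) -> (forall x, 0 <= x <= L -> a x < 0) ->
  (forall x, 0 <= x <= L -> is_derive Z x (a x * Z x + h x)) -> Z 0 = Z L ->
  (forall x, 0 <= x <= L -> h x <= - a x * B) ->
  forall x, 0 <= x <= L -> Z x <= B.
Proof.
  intros HL Ha neg HZ per Hh.
  set (P := fun y => RInt a 0 y).
  assert (HP : forall t, is_derive P t (a t)) by now apply is_derive_primitive.
  assert (P0 : P 0 = 0) by (unfold P; rewrite RInt_point; reflexivity).
  assert (PL : P L < 0) by now apply primitive_negative.
  clearbody P. set (Y := fun x => exp (- P x) * (Z x - B)).
  assert (decr : forall x, 0 <= x <= L -> Y x <= Z 0 - B).
  { intros x Hx.
    destruct (mean_value Y (fun t => exp (- P t) * (h t + a t * B)) 0 x)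
      as [c [Hc E]]; [lra| |].
    - intros t Ht. assert (HPt := HP t).
      assert (HZt : is_derive Z t (a t * Z t + h t)) by (apply HZ; lra).
      unfold Y. auto_derive.
      + split; [now exists (a t)|split; [now exists (a t * Z t + h t)|exact I]].
      + rewrite (is_derive_unique _ _ _ HPt : Derive (fun y => P y) t = _).
        rewrite (is_derive_unique _ _ _ HZt : Derive (fun y => Z y) t = _). ring.
    - assert (Y0 : Y 0 = Z 0 - B).
      { unfold Y. rewrite P0, Ropp_0, exp_0. ring. }
      assert (h c + a c * B <= 0) by (specialize (Hh c); lra).
      pose proof (exp_pos (- P c)). cbv beta in E.
      assert (exp (- P c) * (h c + a c * B) * (x - 0) <= 0).
      { rewrite Rmult_assoc. apply Rmult_le_0_l; nra. }
      lra. }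
  assert (Z0 : Z 0 <= B).
  { pose proof (decr L) as E. unfold Y in E. rewrite <- per in E.
    assert (exp (- P L) > 1).
    { rewrite <- exp_0. apply exp_increasing. lra. }
    apply Rnot_lt_le. intro. nra. }
  intros x Hx. specialize (decr x Hx). unfold Y in decr.
  pose proof (exp_pos (- P x)). apply Rnot_lt_le. intro. nra.
Qed.

Lemma periodic_linear_bound (a h Z : R -> R) L m B :
  0 < L -> 0 < m -> (forall x, continuous a x) ->
  (forall x, 0 <= x <= L -> a x <= - m) ->
  (forall x, 0 <= x <= L -> is_derive Z x (a x * Z x + h x)) -> Z 0 = Z L ->
  0 <= B -> (forall x, 0 <= x <= L -> Rabs (h x) <= m * B) ->
  forall x, 0 <= x <= L -> Rabs (Z x) <= B.
Proof.
  intros HL Hm Ha neg HZ per HB Hh x Hx.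
  assert (neg' : forall t, 0 <= t <= L -> a t < 0).
  { intros t Ht. specialize (neg t Ht). lra. }
  apply Rabs_le. split.
  - enough (- Z x <= B) by lra.
    apply (periodic_linear_le a (fun t => - h t) (fun t => - Z t) L B); auto.
    + intros t Ht. replace (a t * - Z t + - h t) with (- (a t * Z t + h t)) by ring.
      now apply (is_derive_opp (V := R_NormedModule)), HZ.
    + now rewrite per.
    + intros t Ht. specialize (neg t Ht). specialize (Hh t Ht).
      apply Rabs_le_between in Hh. nra.
  - apply (periodic_linear_le a h Z L B); auto.
    intros t Ht. specialize (neg t Ht). specialize (Hh t Ht).
    apply Rabs_le_between in Hh. nra.
Qed.

(** Variation of constants; the initial value
    [exp (P L) / (1 - exp (P L)) * I L] is the one for which the solution takes the
    same value at [0] and at [L]. *)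
Definition periodic_linear_solution (L : R) (a h : R -> R) (x : R) : R :=
  let P y := RInt a 0 y in
  let I y := RInt (fun s => exp (- P s) * h s) 0 y in
  exp (P x) * (exp (P L) / (1 - exp (P L)) * I L + I x).

Lemma periodic_linear_solution_spec (a h : R -> R) L :
  0 < L -> (forall x, continuous a x) -> (forall x, continuous h x) ->
  (forall x, 0 <= x <= L -> a x < 0) ->
  (forall x, is_derive (periodic_linear_solution L a h) x
               (a x * periodic_linear_solution L a h x + h x)) /\
  periodic_linear_solution L a h 0 = periodic_linear_solution L a h L.
Proof.
  intros HL Ha Hh neg. unfold periodic_linear_solution.
  set (P := fun y => RInt a 0 y). cbv zeta.
  set (I := fun y => RInt (fun s => exp (- P s) * h s) 0 y).
  assert (HP : forall x, is_derive P x (a x)) by now apply is_derive_primitive.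
  assert (P0 : P 0 = 0) by (unfold P; rewrite RInt_point; reflexivity).
  assert (PL : P L < 0) by now apply primitive_negative.
  assert (HI : forall x, is_derive I x (exp (- P x) * h x)).
  { apply is_derive_primitive. intro x.
    apply (continuous_mult (K := R_AbsRing)); [|apply Hh].
    apply continuous_comp; [|apply continuous_exp].
    apply (continuous_opp (V := R_NormedModule)).
    now apply (is_derive_continuous P a). }
  assert (I0 : I 0 = 0) by (unfold I; rewrite RInt_point; reflexivity).
  clearbody I. clearbody P. split.
  - intro x. specialize (HP x). specialize (HI x).
    change (is_derive (fun x => exp (P x) * (exp (P L) / (1 - exp (P L)) * I L + I x)) x
      (a x * (exp (P x) * (exp (P L) / (1 - exp (P L)) * I L + I x)) + h x)).
    generalize (exp (P L) / (1 - exp (P L)) * I L). intro c.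
    auto_derive.
    + split; [now exists (a x)|split; [now eexists; exact HI|exact Logic.I]].
    + rewrite (is_derive_unique _ _ _ HP : Derive (fun y => P y) x = _).
      rewrite (is_derive_unique _ _ _ HI : Derive (fun y => I y) x = _).
      rewrite exp_Ropp. field. apply Rgt_not_eq, exp_pos.
  - change (exp (P 0) * (exp (P L) / (1 - exp (P L)) * I L + I 0) =
            exp (P L) * (exp (P L) / (1 - exp (P L)) * I L + I L)).
    assert (exp (P L) < 1) by (rewrite <- exp_0; now apply exp_increasing).
    rewrite I0, P0, exp_0. field. lra.
Qed.

(** * Fixed points of contractions of continuous functions *)

Lemma geometric_small r e :
  0 < e -> exists N, forall k, (N <= k)%nat -> 2 * r * (1 / 2) ^ k < e.
Proof.
  intro He.
  destruct (pow_lt_1_zero (1 / 2)) with (y := e / (2 * Rabs r + 1)) as [N HN].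
  { rewrite Rabs_pos_eq; lra. }
  { pose proof (Rabs_pos r). apply Rdiv_lt_0_compat; lra. }
  exists N. intros k Hk. specialize (HN k Hk).
  assert (0 < (1 / 2) ^ k) by (apply pow_lt; lra).
  rewrite Rabs_pos_eq in HN by lra.
  pose proof (Rabs_pos r). pose proof (Rle_abs r).
  apply Rlt_div_r in HN; [|lra]. nra.
Qed.

(** The Banach fixed point theorem for the uniform distance on a closed ball of
    continuous functions: the iterates from [0] converge uniformly, so the limit is
    continuous and again in the ball. *)
Lemma halving_fixed_point (T : (R -> R) -> R -> R) (r : R) :
  let ball z := (forall x, continuous z x) /\ (forall x, Rabs (z x) <= r) in
  0 <= r ->
  (forall z, ball z -> ball (T z)) ->
  (forall z1 z2 d, ball z1 -> ball z2 ->
     (forall x, Rabs (z1 x - z2 x) <= d) ->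
     forall x, Rabs (T z1 x - T z2 x) <= d / 2) ->
  exists z, ball z /\ forall x, T z x = z x.
Proof.
  intros ball Hr stable contr.
  set (zs := fun k => Nat.iter k T (fun _ => 0)).
  assert (Hb : forall k, ball (zs k)).
  { induction k as [|k IH]; [|now apply stable].
    split; intro x; [apply continuous_const|]. simpl. now rewrite Rabs_R0. }
  assert (step : forall k x, Rabs (zs (S k) x - zs k x) <= r * (1 / 2) ^ k).
  { induction k as [|k IH]; intro x.
    - change (zs 0%nat x) with 0. rewrite Rminus_0_r, Rmult_1_r. apply Hb.
    - replace (r * (1 / 2) ^ S k) with (r * (1 / 2) ^ k / 2) by (simpl; field).
      now apply (contr (zs (S k)) (zs k)). }
  assert (tail : forall j k x,
             Rabs (zs (k + j)%nat x - zs k x) <= 2 * r * (1 / 2) ^ k).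
  { induction j as [|j IH]; intros k x.
    - rewrite Nat.add_0_r, Rminus_diag, Rabs_R0.
      apply Rmult_le_pos; [lra|apply pow_le; lra].
    - specialize (IH (S k) x). specialize (step k x).
      rewrite <- Nat.add_succ_comm.
      replace (2 * r * (1 / 2) ^ S k) with (r * (1 / 2) ^ k) in IH
        by (simpl; field).
      replace (zs (S k + j)%nat x - zs k x)
        with ((zs (S k + j)%nat x - zs (S k) x) + (zs (S k) x - zs k x)) by ring.
      eapply Rle_trans; [apply Rabs_triang|]. lra. }
  assert (lim : forall x, exists l, is_lim_seq (fun k => zs k x) (Finite l)).
  { intro x. apply ex_lim_seq_cauchy_corr. intro e.
    destruct (geometric_small r (e / 2)) as [N HN];
      [destruct e; simpl; lra|]. exists N. intros p q Hp Hq.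
    assert (near : forall i, (N <= i)%nat -> Rabs (zs i x - zs N x) < e / 2).
    { intros i Hi. replace i with (N + (i - N))%nat by lia.
      eapply Rle_lt_trans; [apply tail|now apply HN]. }
    apply near in Hp, Hq. apply Rabs_def2 in Hp, Hq.
    apply Rabs_def1; lra. }
  (* The uniform limit of the iterates, taken pointwise. *)
  set (z := fun x => real (Lim_seq (fun k => zs k x))).
  assert (Hlim : forall x, is_lim_seq (fun k => zs k x) (z x)).
  { intro x. destruct (lim x) as [l Hl]. unfold z.
    rewrite (is_lim_seq_unique _ _ Hl). exact Hl. }
  assert (dist : forall k x, Rabs (z x - zs k x) <= 2 * r * (1 / 2) ^ k).
  { intros k x.
    refine (is_lim_seq_le (fun j => Rabs (zs (j + k)%nat x - zs k x))
      (fun _ => 2 * r * (1 / 2) ^ k) (Finite _) (Finite _) _ _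
      (is_lim_seq_const _)).
    - intro j. rewrite Nat.add_comm. apply tail.
    - apply (is_lim_seq_abs _ (Finite (z x - zs k x))), is_lim_seq_minus'.
      + now apply (is_lim_seq_incr_n (fun j => zs j x)).
      + apply is_lim_seq_const. }
  assert (zball : ball z).
  { split; intro x.
    - apply continuity_pt_filterlim.
      apply (CVU_continuity zs z x (mkposreal 1 Rlt_0_1)).
      + intros e He. destruct (geometric_small r e He) as [N HN].
        exists N. intros k y Hk _.
        eapply Rle_lt_trans; [apply dist|now apply HN].
      + intros k y _. apply continuity_pt_filterlim, Hb.
      + unfold Boule. simpl. rewrite Rminus_diag, Rabs_R0. lra.
    - refine (is_lim_seq_le (fun k => Rabs (zs k x)) (fun _ => r) (Finite _)
        (Finite _) _ _ (is_lim_seq_const _)).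
      + intro k. apply Hb.
      + now apply (is_lim_seq_abs _ (Finite (z x))). }
  exists z. split; [exact zball|]. intro x. apply cond_eq. intros e He.
  destruct (geometric_small r e He) as [N HN]. specialize (HN N (Nat.le_refl _)).
  pose proof (contr z (zs N) _ zball (Hb N) (dist N) x) as D1.
  change (T (zs N) x) with (zs (S N) x) in D1.
  pose proof (dist (S N) x) as D2.
  replace (2 * r * (1 / 2) ^ S N) with (2 * r * (1 / 2) ^ N / 2) in D2
    by (simpl; field).
  apply Rabs_le_between in D1, D2. apply Rabs_def1; lra.
Qed.

(** The linear estimates hold on [[0, L]] only.  Composing with the retraction onto
    this interval turns them into estimates on the whole line, where continuity and
    integrals can be used without end points. *)
Definition clamp (L x : R) : R := Rmax 0 (Rmin x L).

Lemma clamp_range L x : 0 <= L -> 0 <= clamp L x <= L.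
Proof. unfold clamp, Rmax, Rmin. repeat destruct Rle_dec; lra. Qed.

Lemma clamp_id L x : 0 <= x <= L -> clamp L x = x.
Proof. unfold clamp, Rmax, Rmin. repeat destruct Rle_dec; lra. Qed.

Lemma clamp_continuous L x : continuous (clamp L) x.
Proof.
  apply continuity_pt_filterlim. intros e He. exists e. split; [exact He|].
  intros y [_ Hy]. eapply Rle_lt_trans; [|exact Hy].
  simpl. unfold R_dist, clamp, Rmax, Rmin.
  repeat destruct Rle_dec; unfold Rabs; repeat destruct Rcase_abs; lra.
Qed.

(** * The Riccati equation of the correction *)

(** In the ball of radius [r = 2 kappa / mu], the term [z^2 / 2 - rho] is bounded by
    [r^2 / 2 + kappa <= mu r], so the periodic solution stays in the ball; and
    [z^2 / 2] has Lipschitz constant [r <= mu / 2] there, so the linear estimate makes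
    the map a contraction of ratio [1 / 2].  Both inequalities come from
    [4 kappa <= mu^2], in which [eps] does not occur. *)
Lemma periodic_riccati (w rho : R -> R) L mu eps kappa :
  0 < L -> 0 < mu -> 0 < eps -> 0 <= kappa -> 4 * kappa <= mu ^ 2 ->
  (forall x, continuous w x) -> (forall x, continuous rho x) ->
  (forall x, 0 <= x <= L -> w x <= - mu) ->
  (forall x, 0 <= x <= L -> Rabs (rho x) <= kappa) ->
  exists Z, Z 0 = Z L /\
    (forall x, ex_derive Z x /\ continuous (Derive Z) x) /\
    (forall x, 0 <= x <= L ->
       eps * Derive Z x = w x * Z x + Z x ^ 2 / 2 - rho x /\
       Rabs (Z x) <= 2 * kappa / mu).
Proof.
  intros HL Hmu Heps Hk small Hw Hrho neg rho_le.
  set (r := 2 * kappa / mu).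
  assert (r_eq : mu * r = 2 * kappa) by (unfold r; field; lra).
  assert (Hr : 0 <= r) by (apply Rmult_le_reg_l with mu; lra).
  assert (r_le : r <= mu / 2) by (apply Rmult_le_reg_l with mu; nra).
  set (a := fun x => w x / eps).
  set (h := fun (z : R -> R) x => (z x ^ 2 / 2 - rho x) / eps).
  set (S := fun z => periodic_linear_solution L a (h z)).
  set (m := mu / eps).
  assert (Hm : 0 < m) by now apply Rdiv_lt_0_compat.
  assert (Ha : forall x, continuous a x).
  { intro x. apply (continuous_mult (K := R_AbsRing));
      [apply Hw|apply continuous_const]. }
  assert (a_le : forall x, 0 <= x <= L -> a x <= - m).
  { intros x Hx. unfold a, m. replace (- (mu / eps)) with (- mu / eps) by (field; lra).
    apply Rmult_le_compat_r; [|now apply neg].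
    left. now apply Rinv_0_lt_compat. }
  assert (Hh : forall z, (forall x, continuous z x) -> forall x, continuous (h z) x).
  { intros z Hz x. unfold h.
    apply (continuous_mult (K := R_AbsRing)); [|apply continuous_const].
    apply (continuous_minus (V := R_NormedModule)); [|apply Hrho].
    apply (continuous_mult (K := R_AbsRing)); [|apply continuous_const].
    apply (continuous_ext (fun y => z y * z y)); [intro; simpl; ring|].
    apply (continuous_mult (K := R_AbsRing)); apply Hz. }
  assert (spec : forall z, (forall x, continuous z x) ->
    (forall x, is_derive (S z) x (a x * S z x + h z x)) /\ S z 0 = S z L).
  { intros z Hz. apply periodic_linear_solution_spec; auto.
    intros x Hx. specialize (a_le x Hx). lra. }
  assert (div_le : forall y b, Rabs y <= mu * b -> Rabs (y / eps) <= m * b).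
  { intros y b H. unfold Rdiv. rewrite Rabs_mult.
    rewrite (Rabs_pos_eq (/ eps)) by (left; now apply Rinv_0_lt_compat).
    unfold m. replace (mu / eps * b) with ((mu * b) * / eps) by (field; lra).
    apply Rmult_le_compat_r; [|exact H]. left. now apply Rinv_0_lt_compat. }
  (* On the interval the clamped fixed point coincides with [S z], which, unlike
     [z], is differentiable on the whole line. *)
  destruct (halving_fixed_point (fun z x => S z (clamp L x)) r Hr)
    as [z [[Hz z_le] fix_z]].
  - intros z [Hz z_le]. destruct (spec z Hz) as [D per]. split; intro x.
    + apply (continuous_comp (clamp L) (S z)); [apply clamp_continuous|].
      apply (is_derive_continuous _ (fun t => a t * S z t + h z t)), D.
    + apply (periodic_linear_bound a (h z) (S z) L m r); auto;
        [|apply clamp_range; lra].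
      intros t Ht. apply div_le.
      specialize (rho_le t Ht). specialize (z_le t).
      apply Rabs_le_between in rho_le. apply Rabs_le_between in z_le.
      apply Rabs_le. nra.
  - intros z1 z2 d [Hz1 z1_le] [Hz2 z2_le] Hd x.
    destruct (spec z1 Hz1) as [D1 per1]. destruct (spec z2 Hz2) as [D2 per2].
    assert (d0 : 0 <= d) by (eapply Rle_trans; [apply Rabs_pos|apply (Hd 0)]).
    apply (periodic_linear_bound a (fun t => h z1 t - h z2 t)
      (fun t => S z1 t - S z2 t) L m (d / 2)); auto;
      [| |lra| |apply clamp_range; lra].
    (* The difference of two solutions solves the linear equation whose source is
       the difference of the sources. *)
    + intros t _.
      replace (a t * (S z1 t - S z2 t) + (h z1 t - h z2 t)) with
        ((a t * S z1 t + h z1 t) - (a t * S z2 t + h z2 t)) by ring.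
      now apply (is_derive_minus (V := R_NormedModule)).
    + now rewrite per1, per2.
    + intros t _.
      replace (h z1 t - h z2 t) with (((z1 t + z2 t) / 2 * (z1 t - z2 t)) / eps)
        by (unfold h; field; lra).
      apply div_le. rewrite Rabs_mult.
      replace (mu * (d / 2)) with (mu / 2 * d) by field.
      apply Rmult_le_compat; try apply Rabs_pos; [|apply Hd].
      specialize (z1_le t). specialize (z2_le t).
      apply Rabs_le_between in z1_le. apply Rabs_le_between in z2_le.
      apply Rabs_le. lra.
  - destruct (spec z Hz) as [D per]. exists (S z). split; [exact per|]. split.
    + intro x. split; [eexists; apply D|].
      apply (continuous_ext (fun x => a x * S z x + h z x)).
      { intro t. symmetry. apply is_derive_unique, D. }
      apply (continuous_plus (V := R_NormedModule)); [|now apply Hh].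
      apply (continuous_mult (K := R_AbsRing)); [apply Ha|].
      apply (is_derive_continuous _ (fun t => a t * S z t + h z t)), D.
    + intros x Hx. specialize (fix_z x). rewrite (clamp_id L x Hx) in fix_z.
      rewrite (is_derive_unique _ _ _ (D x)), fix_z.
      split; [unfold a, h; field; lra|apply z_le].
Qed.

(** * From the correction to the solution *)

Lemma smooth_ex_derive g x : smooth g -> ex_derive g x.
Proof. intro H. exact (H 1%nat x). Qed.

Lemma smooth_continuous g x : smooth g -> continuous g x.
Proof. intro H. apply (ex_derive_continuous (V := R_NormedModule)), (H 1%nat x). Qed.

Lemma smooth_Derive_continuous g x : smooth g -> continuous (Derive g) x.
Proof. intro H. apply (ex_derive_continuous (V := R_NormedModule)), (H 2%nat x). Qed.

Lemma uniform_bound (g : nat -> R -> R) n a b :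
  (forall k x, continuous (g k) x) ->
  exists M, 1 <= M /\
    forall k x, (k <= n)%nat -> a <= x <= b -> Rabs (g k x) <= M.
Proof.
  intro Hg.
  assert (one : forall k, exists M, forall x, a <= x <= b -> Rabs (g k x) <= M).
  { intro k. destruct (bounded_continuity (V := R_NormedModule) (g k) a b) as [M HM].
    - intros x _. apply Hg.
    - exists M. intros x Hx. left. now apply HM. }
  induction n as [|n [M [M1 HM]]].
  - destruct (one 0%nat) as [M HM]. exists (Rmax 1 M). split; [apply Rmax_l|].
    intros k x Hk Hx. replace k with 0%nat by lia.
    eapply Rle_trans; [now apply HM|apply Rmax_r].
  - destruct (one (S n)) as [M' HM']. exists (Rmax M M'). split.
    + eapply Rle_trans; [exact M1|apply Rmax_l].
    + intros k x Hk Hx. destruct (Nat.eq_dec k (S n)) as [->|ne].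
      * eapply Rle_trans; [now apply HM'|apply Rmax_r].
      * eapply Rle_trans; [apply HM; [lia|exact Hx]|apply Rmax_l].
Qed.

Lemma pow_S_le x n : 0 <= x <= 1 -> x ^ S n <= x.
Proof.
  intro Hx. rewrite <- (Rmult_1_r x) at 2. apply (Rmult_le_compat_l x (x ^ n)); [lra|].
  rewrite <- (pow1 n). now apply pow_incr.
Qed.

Lemma partial_expansion_near_leading u n M eps x :
  0 <= eps <= 1 -> (forall k, (k <= n)%nat -> Rabs (u k x) <= M) ->
  Rabs (partial_expansion u n eps x - u 0%nat x) <= INR n * M * eps.
Proof.
  intro Heps. unfold partial_expansion. induction n as [|n IH]; intro HM.
  - rewrite sum_O. simpl. rewrite Rmult_1_l, Rminus_diag, Rabs_R0. lra.
  - rewrite sum_Sn, S_INR. change plus with Rplus.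
    assert (IH' := IH (fun k Hk => HM k (Nat.le_le_succ_r _ _ Hk))).
    assert (last : Rabs (eps ^ S n * u (S n) x) <= M * eps).
    { rewrite Rabs_mult, <- RPow_abs, (Rabs_pos_eq eps), Rmult_comm by lra.
      apply Rmult_le_compat; [apply Rabs_pos|apply pow_le; lra|now apply HM|].
      now apply pow_S_le. }
    apply Rabs_le_between in IH'. apply Rabs_le_between in last.
    apply Rabs_le. lra.
Qed.

Lemma is_derive_partial_expansion u n eps x :
  (forall k, smooth (u k)) ->
  is_derive (partial_expansion u n eps) x
    (sum_n (fun k => eps ^ k * Derive (u k) x) n).
Proof.
  intro Hu.
  apply (is_derive_sum_n (V := R_NormedModule) (fun k y => eps ^ k * u k y)).
  intros k _. apply is_derive_scal, Derive_correct, smooth_ex_derive, Hu.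
Qed.

Lemma is_derive_D_in (g dg : R -> R) (D : R -> Prop) x :
  is_derive g x (dg x) -> D_in g dg D x.
Proof.
  intro H. apply (D_in_imp g dg no_cond D); [easy|].
  now apply derivable_pt_lim_D_in, is_derive_Reals.
Qed.

(** Differentiating [eps v' = (v^2 - u0^2) / 2] gives [eps v'' = v v' - u0 u0'].  The
    first and second derivatives are taken to be the right-hand sides of these two
    identities divided by [eps].  The first one is differentiable on the whole line,
    although it equals [v'] on the period only, so one-sided derivatives at the end
    points are restrictions of two-sided ones. *)
Lemma periodic_C2_solution_of_first_integral f u0 eps v :
  0 < eps -> smooth u0 -> (forall x, u0 x * Derive u0 x = f x) ->
  (forall x, ex_derive v x /\ continuous (Derive v) x) ->
  (forall x, period_interval x -> eps * Derive v x = (v x ^ 2 - u0 x ^ 2) / 2) ->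
  v 0 = v (2 * PI) ->
  periodic_C2_solution f eps v.
Proof.
  intros Heps Hu0 Hf Hv ode per.
  set (dv := fun x => (v x ^ 2 - u0 x ^ 2) / (2 * eps)).
  set (ddv := fun x => (v x * Derive v x - u0 x * Derive u0 x) / eps).
  assert (dv_eq : forall x, period_interval x -> Derive v x = dv x).
  { intros x Hx. specialize (ode x Hx). unfold dv.
    apply (Rmult_eq_reg_l eps); [|lra]. rewrite ode. field. lra. }
  exists dv, ddv. repeat split.
  - intros x Hx. apply (D_in_ext (Derive v)); [now apply dv_eq|].
    apply is_derive_D_in, Derive_correct, Hv.
  - intros x Hx. apply is_derive_D_in. unfold dv, ddv.
    auto_derive.
    + repeat split; [apply Hv|now apply smooth_ex_derive].
    + change (fun t => v t) with v. change (fun t => u0 t) with u0. field. lra.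
  - apply continuous_on_forall. intros x _. unfold ddv.
    apply (continuous_mult (K := R_AbsRing)); [|apply continuous_const].
    apply (continuous_minus (V := R_NormedModule));
      apply (continuous_mult (K := R_AbsRing)).
    + apply (ex_derive_continuous (V := R_NormedModule)), Hv.
    + apply Hv.
    + now apply smooth_continuous.
    + now apply smooth_Derive_continuous.
  - intros x Hx. unfold ddv. rewrite <- dv_eq by exact Hx.
    rewrite <- Hf. field. lra.
  - exact per.
Qed.

Lemma partial_expansion_periodic u n eps :
  (forall k, periodic (u k)) ->
  partial_expansion u n eps 0 = partial_expansion u n eps (2 * PI).
Proof.
  intro per. apply sum_n_ext. intro k.
  specialize (per k 0). rewrite Rplus_0_l in per. now rewrite per.
Qed.

Theorem theorem1p3 (f : R -> R) (u : nat -> R -> R) (n : nat)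
  (f_smooth : smooth f) (f_periodic : periodic f)
  (f_mean : RInt f 0 (2 * PI) = 0)
  (u0_smooth : smooth (u 0%nat)) (u0_periodic : periodic (u 0%nat))
  (u0_neg : forall x : R, u 0%nat x < 0)
  (u0_eq : forall x : R, u 0%nat x * Derive (u 0%nat) x = f x)
  (u_rec : expansion_recurrence u)
  (n_pos : (0 < n)%nat) :
  exists eps0 : R, 0 < eps0 /\
  exists C : R, 0 < C /\
  forall eps : R, 0 < eps < eps0 ->
  exists v : R -> R,
    periodic_C2_solution f eps v /\
    forall x : R, 0 <= x <= 2 * PI ->
      Rabs (v x - sum_n (fun k => eps ^ k * u k x) n) <= C * eps ^ (n + 1).
Proof.
  assert (L_pos : 0 < 2 * PI) by (pose proof PI_RGT_0; lra).
  pose proof (expansion_smooth u u0_smooth u0_neg u_rec) as Hu.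
  pose proof (expansion_periodic u u0_periodic u0_neg u_rec) as Hper.
  (* Half of the distance from [u_0] to [0] is kept for the higher-order terms. *)
  assert (exists mu, 0 < mu /\ forall x, 0 <= x <= 2 * PI -> u 0%nat x <= - (2 * mu))
    as [mu [mu_pos u0_le]].
  { destruct (continuity_ab_maj (u 0%nat) 0 (2 * PI)) as [t [Ht _]]; [lra| |].
    - intros x _. now apply continuity_pt_filterlim, smooth_continuous.
    - exists (- u 0%nat t / 2). specialize (u0_neg t). split; [lra|].
      intros x Hx. specialize (Ht x Hx). lra. }
  destruct (uniform_bound u n 0 (2 * PI)) as [M1 [M1_ge M1_bound]].
  { intros k x. now apply smooth_continuous. }
  destruct (uniform_bound (fun k => Derive (u k)) n 0 (2 * PI)) as [M2 [M2_ge M2_bound]].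
  { intros k x. now apply smooth_Derive_continuous. }
  set (M := Rmax M1 M2).
  assert (HM1 : M1 <= M) by apply Rmax_l.
  assert (HM2 : M2 <= M) by apply Rmax_r.
  set (K := M + INR n * (INR n * M ^ 2)).
  assert (n_ge : 0 < INR n) by now apply lt_0_INR.
  assert (K_pos : 0 < K).
  { apply Rplus_lt_le_0_compat; [lra|].
    repeat apply Rmult_le_pos; try lra. }
  (* Below [e1] the expansion stays below [- mu], since [|w - u_0| <= n M eps];
     below [e2] the residual bound [kappa = K eps^(n+1) <= K eps] satisfies
     [4 kappa <= mu^2]. *)
  set (e1 := mu / (INR n * M)). set (e2 := mu ^ 2 / (4 * K)).
  assert (nM_pos : 0 < INR n * M) by (apply Rmult_lt_0_compat; lra).
  assert (e1_pos : 0 < e1) by (apply Rdiv_lt_0_compat; lra).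
  assert (e2_pos : 0 < e2).
  { apply Rdiv_lt_0_compat; [apply pow_lt|]; lra. }
  exists (Rmin 1 (Rmin e1 e2)). split; [repeat apply Rmin_pos; lra|].
  exists (2 * K / mu). split; [apply Rdiv_lt_0_compat; lra|].
  intros eps [eps_pos eps_lt].
  assert (eps < 1 /\ eps < e1 /\ eps < e2) as [eps_1 [eps_e1 eps_e2]].
  { apply Rmin_Rgt_l in eps_lt as [H1 H2]. apply Rmin_Rgt_l in H2. lra. }
  apply Rlt_div_r in eps_e1; [|lra]. apply Rlt_div_r in eps_e2; [|lra].
  set (w := partial_expansion u n eps).
  set (dw := fun x => sum_n (fun k => eps ^ k * Derive (u k) x) n).
  assert (Hw : forall x, is_derive w x (dw x)).
  { intro x. now apply is_derive_partial_expansion. }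
  assert (w_cont : forall x, continuous w x).
  { intro x. now apply (is_derive_continuous w dw). }
  assert (dw_cont : forall x, continuous dw x).
  { intro x. apply (ex_derive_continuous (V := R_NormedModule)). eexists.
    apply (is_derive_sum_n (V := R_NormedModule) (fun k y => eps ^ k * Derive (u k) y)).
    intros k _. apply is_derive_scal, Derive_correct, (Hu k 2%nat x). }
  destruct (periodic_riccati w
    (fun x => eps * dw x - (w x ^ 2 - u 0%nat x ^ 2) / 2)
    (2 * PI) mu eps (K * eps ^ (n + 1))) as [Z [Z_per [Z_C1 HZ]]]; auto.
  - apply Rmult_le_pos; [lra|apply pow_le; lra].
  - assert (eps ^ (n + 1) <= eps).
    { rewrite Nat.add_1_r. apply pow_S_le. lra. }
    nra.
  - intro x.
    apply (continuous_minus (V := R_NormedModule)).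
    + apply (continuous_mult (K := R_AbsRing)); [apply continuous_const|apply dw_cont].
    + apply (ex_derive_continuous (V := R_NormedModule)). auto_derive.
      repeat split; [now exists (dw x)|now apply smooth_ex_derive].
  - intros x Hx. specialize (u0_le x Hx).
    assert (near : Rabs (w x - u 0%nat x) <= INR n * M * eps).
    { apply partial_expansion_near_leading; [lra|]. intros k Hk.
      eapply Rle_trans; [now apply M1_bound|exact HM1]. }
    apply Rabs_le_between in near. lra.
  - intros x Hx. apply partial_expansion_residual; auto; [lra| |].
    + intros k Hk. eapply Rle_trans; [now apply M1_bound|exact HM1].
    + eapply Rle_trans; [now apply (M2_bound n)|exact HM2].
  - assert (Hv : forall x, is_derive (fun y => w y + Z y) x (dw x + Derive Z x)).
    { intro x. apply (is_derive_plus (V := R_NormedModule)); [apply Hw|].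
      apply Derive_correct, Z_C1. }
    exists (fun x => w x + Z x). split.
    + apply (periodic_C2_solution_of_first_integral f (u 0%nat)); auto.
      * intro x. split; [eexists; apply Hv|].
        apply (continuous_ext (fun x => dw x + Derive Z x)).
        { intro t. symmetry. apply is_derive_unique, Hv. }
        apply (continuous_plus (V := R_NormedModule)); [apply dw_cont|apply Z_C1].
      * intros x Hx.
        replace (Derive (fun y => w y + Z y) x) with (dw x + Derive Z x)
          by (symmetry; apply is_derive_unique, Hv).
        destruct (HZ x Hx) as [ode _]. lra.
      * rewrite Z_per. unfold w. now rewrite partial_expansion_periodic.
    + intros x Hx. fold (partial_expansion u n eps x). fold w.
      rewrite Rplus_minus_l.
      replace (2 * K / mu * eps ^ (n + 1)) with (2 * (K * eps ^ (n + 1)) / mu)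
        by (field; lra).
      now apply HZ.
Qed.
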